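(* Let $\mathbb{K}$ be a field and let $V$ be a vector space over $\mathbb{K}$ with finite positive dimension. Let $A,A^*$ be a tridiagonal pair on $V$, with eigenspaces of $A$ ordered as $V_0,V_1,\ldots,V_d$ and eigenspaces of $A^*$ ordered as $V^*_0,V^*_1,\ldots,V^*_d$ so as to satisfy conditions (ii) and (iii) in the definition of a tridiagonal pair. Let $A',A^{*\prime}$ be a second tridiagonal pair on $V$, with eigenspaces of $A'$ ordered as $V'_0,V'_1,\ldots,V'_d$ and eigenspaces of $A^{*\prime}$ ordered as $V^{*\prime}_0,V^{*\prime}_1,\ldots,V^{*\prime}_d$ so as to satisfy conditions (ii) and (iii) for the pair $A',A^{*\prime}$. Assume $V_i=V'_i$ and $V^*_i=V^{*\prime}_i$ for $0\le i\le d$. Then $\mathrm{Span}\{A,I\}=\mathrm{Span}\{A',I\}$ and $\mathrm{Span}\{A^*,I\}=\mathrm{Span}\{A^{*\prime},I\}$.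
   Context: $\mathrm{End}(V)$ denotes the $\mathbb{K}$-algebra of all $\mathbb{K}$-linear transformations from $V$ to $V$, and $I$ is its identity. For $A\in\mathrm{End}(V)$, a subspace $W\subseteq V$ is an eigenspace of $A$ whenever $W\neq 0$ and there exists $\theta\in\mathbb{K}$ such that $W=\{v\in V\mid Av=\theta v\}$. $A$ is diagonalizable whenever $V$ is spanned by the eigenspaces of $A$. A tridiagonal pair on $V$ is an ordered pair $A,A^*$ of elements of $\mathrm{End}(V)$ such that: (i) each of $A,A^*$ is diagonalizable; (ii) there exists an ordering $V_0,V_1,\ldots,V_d$ of the eigenspaces of $A$ (all of them, each listed once) such that $A^*V_i\subseteq V_{i-1}+V_i+V_{i+1}$ for $0\le i\le d$, where $V_{-1}=0$, $V_{d+1}=0$; (iii) there exists an ordering $V^*_0,V^*_1,\ldots,V^*_\delta$ of the eigenspaces of $A^*$ (all of them, each listed once) such that $AV^*_i\subseteq V^*_{i-1}+V^*_i+V^*_{i+1}$ for $0\le i\le\delta$, where $V^*_{-1}=0$, $V^*_{\delta+1}=0$; (iv) there is no subspace $W$ of $V$ such that both $AW\subseteq W$ and $A^*W\subseteq W$, other than $W=0$ and $W=V$. Here $A^*$ is just a name for the second transformation (it is not the conjugate-transpose or adjoint of $A$). It is known that $d=\delta$ for every tridiagonal pair. $\mathrm{Span}$ means the $\mathbb{K}$-linear span in $\mathrm{End}(V)$. *)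

(* Defs.v *)
From mathcomp Require Import all_boot all_order all_algebra.

Set Implicit Arguments.
Unset Strict Implicit.
Unset Printing Implicit Defensive.

Import GRing.Theory.
Local Open Scope ring_scope.

Definition is_leigenspace (K : fieldType) (V : vectType K)
    (A : 'End(V)) (W : {vspace V}) : Prop :=
  W <> 0%VS /\ exists theta : K, W = passmx.leigenspace A theta.

Definition ldiagonalizable (K : fieldType) (V : vectType K)
    (A : 'End(V)) : Prop :=
  exists Ws : seq {vspace V},
    (forall W, W \in Ws -> is_leigenspace A W) /\
    (\sum_(W <- Ws) W)%VS = fullv.

Definition leigenspace_ordering (K : fieldType) (V : vectType K)
    (A : 'End(V)) (d : nat) (W : 'I_d.+1 -> {vspace V}) : Prop :=
  injective W /\
  forall U : {vspace V}, is_leigenspace A U <-> exists i, U = W i.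

(* The sum ranges over the j in {i-1, i, i+1} that lie in {0, ..., d}, which
   implements the convention W_{-1} = W_{d+1} = 0. *)
Definition tridiagonal_action (K : fieldType) (V : vectType K)
    (B : 'End(V)) (d : nat) (W : 'I_d.+1 -> {vspace V}) : Prop :=
  forall i : 'I_d.+1,
    (B @: W i <= \sum_(j < d.+1 | (i <= j.+1)%N && (j <= i.+1)%N) W j)%VS.

Definition standard_ordering (K : fieldType) (V : vectType K)
    (A B : 'End(V)) (d : nat) (W : 'I_d.+1 -> {vspace V}) : Prop :=
  leigenspace_ordering A W /\ tridiagonal_action B W.

Record tridiagonal_pair (K : fieldType) (V : vectType K)
    (A As : 'End(V)) : Prop := TridiagonalPair {
  tdp_diag : ldiagonalizable A;
  tdp_diag_dual : ldiagonalizable As;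
  tdp_ordering :
    exists (d : nat) (W : 'I_d.+1 -> {vspace V}), standard_ordering A As W;
  tdp_ordering_dual :
    exists (d : nat) (W : 'I_d.+1 -> {vspace V}), standard_ordering As A W;
  tdp_irreducible : forall W : {vspace V},
    (A @: W <= W)%VS -> (As @: W <= W)%VS -> W = 0%VS \/ W = fullv }.

(* Main.v *)
Require Import Defs.
From mathcomp Require Import all_boot all_order all_algebra.

(** The flags [F_k = V*_0 + ... + V*_(k-1)] and [G_k = V_k + ... + V_d] meet
    trivially, because the sum over k of the [F_k :&: G_k] is a proper subspace
    invariant under [A] and [A*]. By symmetry [V*_0] meets
    [V_0 + ... + V_(d-1)] trivially as well. Put
    [N_k = (A - th_0) ... (A - th_(k-1))]. As [A'] is a scalar on each
    eigenspace of [A], it has a Newton expansion in the [N_k]; let [r] be the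
    largest index with a nonzero coefficient. If [r >= 2], then, as [A'] maps
    [V*_0] into [F_2], the map [N_r] sends [V*_0] into [F_r], one step lower
    than expected; hence [N_d] sends [V*_0] into [F_d :&: G_d = 0]. So [V*_0]
    lies in [ker N_d = V_0 + ... + V_(d-1)], and [V*_0 = 0], a contradiction.
    Thus [r <= 1]. *)

Section TridiagonalPairs.

Set Implicit Arguments.
Unset Strict Implicit.
Unset Printing Implicit Defensive.

Import GRing.Theory.
Local Open Scope ring_scope.

Variables (K : fieldType) (V : vectType K).
Implicit Types (A As B : 'End(V)) (th c e : nat -> K).

Lemma limg_subvP A (U U' : {vspace V}) :
  reflect (forall v, v \in U -> A v \in U') (A @: U <= U')%VS.
Proof.
apply: (iffP subvP) => [sAU v Uv | sAU _ /memv_imgP[v Uv ->]]; last exact: sAU.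
exact/sAU/memv_img.
Qed.

Lemma tridiagonal_pair_sym A As :
  tridiagonal_pair A As -> tridiagonal_pair As A.
Proof. by case=> dA dAs oA oAs irr; split=> // U sAs sA; apply: irr. Qed.

(** * Flags and the action of shifted operators *)

Section Flags.

Variable d : nat.
Implicit Types W Ws : 'I_d.+1 -> {vspace V}.

(** The bound is strict here and weak in [upper_flag], so at each [k] the two index sets are
    complementary. *)
Definition lower_flag W k := (\sum_(j < d.+1 | (j < k)%N) W j)%VS.
Definition upper_flag W k := (\sum_(j < d.+1 | (k <= j)%N) W j)%VS.

Lemma lower_flag0 W : lower_flag W 0 = 0%VS.
Proof. exact: big_pred0. Qed.

Lemma upper_flag0 W : upper_flag W 0 = (\sum_j W j)%VS.
Proof. exact: eq_bigl. Qed.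

Lemma upper_flag_ge W : upper_flag W d.+1 = 0%VS.
Proof. by apply: big_pred0 => j; rewrite leqNgt ltn_ord. Qed.

Lemma lower_flagS W k k' :
  (k <= k')%N -> (lower_flag W k <= lower_flag W k')%VS.
Proof.
move=> lekk'; apply/subv_sumP => j ltjk.
by apply: (sumv_sup j) => //; apply: leq_trans lekk'.
Qed.

(** Eigenvalues are indexed by [nat] so that Newton products recurse without bound proofs; only the
    values at indices up to [d] are constrained. *)
Record eigensystem A W th : Prop := Eigensystem {
  eigsys_act : forall (i : 'I_d.+1) v, v \in W i -> A v = th i *: v;
  eigsys_inj : forall i j, (i < d.+1)%N -> (j < d.+1)%N -> th i = th j -> i = j;
  eigsys_full : (\sum_i W i)%VS = fullv;
  eigsys_neq0 : forall i, W i <> 0%VS }.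

Definition shift A a : 'End(V) := A - a *: \1%VF.

Lemma shiftE A a v : shift A a v = A v - a *: v.
Proof. by rewrite add_lfunE opp_lfunE scale_lfunE id_lfunE. Qed.

Lemma shift_lower_flag A W a k :
  tridiagonal_action A W ->
  (shift A a @: lower_flag W k <= lower_flag W k.+1)%VS.
Proof.
move=> tdA; rewrite limg_sum; apply/subv_sumP => i ltik.
apply/limg_subvP => v Wv; rewrite shiftE rpredB //; last first.
  by rewrite rpredZ // (subvP (sumv_sup i _ (subvv _))) //; apply: ltnW.
have /limg_subvP/(_ v Wv) := tdA i; apply/subvP/subv_sumP => j /andP[_ leji].
by apply: (sumv_sup j) => //; apply: leq_ltn_trans leji _.
Qed.

Lemma shift_upper_flag A W a k :
  tridiagonal_action A W ->
  (shift A a @: upper_flag W k <= upper_flag W k.-1)%VS.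
Proof.
move=> tdA; rewrite limg_sum; apply/subv_sumP => i leki.
apply/limg_subvP => v Wv; rewrite shiftE rpredB //; last first.
  rewrite rpredZ // (subvP (sumv_sup i _ (subvv _))) //.
  exact: leq_trans (leq_pred k) leki.
have /limg_subvP/(_ v Wv) := tdA i; apply/subvP/subv_sumP => j /andP[leij _].
by apply: (sumv_sup j) => //; rewrite -ltnS; case: k leki => // k /= ltki;
   apply: leq_trans ltki _.
Qed.

Lemma eig_shift_upper_flag A W th k :
  eigensystem A W th ->
  (shift A (th k) @: upper_flag W k <= upper_flag W k.+1)%VS.
Proof.
move=> eigA; rewrite limg_sum; apply/subv_sumP => i; rewrite leq_eqVlt.
move=> ik; apply/limg_subvP => v Wv; rewrite shiftE (eigsys_act eigA Wv).
case/orP: ik => [/eqP-> | ltki]; first by rewrite subrr mem0v.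
by rewrite -scalerBl rpredZ // (subvP (sumv_sup i _ (subvv _))).
Qed.

Lemma eig_shift_lower_flag A W th k :
  eigensystem A W th ->
  (shift A (th k) @: lower_flag W k.+1 <= lower_flag W k)%VS.
Proof.
move=> eigA; rewrite limg_sum; apply/subv_sumP => i; rewrite ltnS leq_eqVlt.
move=> ik; apply/limg_subvP => v Wv; rewrite shiftE (eigsys_act eigA Wv).
case/orP: ik => [/eqP-> | ltki]; first by rewrite subrr mem0v.
by rewrite -scalerBl rpredZ // (subvP (sumv_sup i _ (subvv _))).
Qed.

(** * Newton products and interpolation *)

Fixpoint newton A th k : 'End(V) :=
  if k is k'.+1 then (shift A (th k') \o newton A th k')%VF else \1%VF.

(** The value at [x] of the polynomial whose value at [A] is [newton A th k]. *)
Definition newton_value th k x : K := \prod_(h < k) (x - th h).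

Lemma newton_eig A W th (i : 'I_d.+1) v k :
  eigensystem A W th -> v \in W i ->
  newton A th k v = newton_value th k (th i) *: v.
Proof.
move=> eigA Wv; elim: k => [|k IHk].
  by rewrite id_lfunE /newton_value big_ord0 scale1r.
rewrite /= comp_lfunE IHk shiftE (eigsys_act eigA (i := i)) ?rpredZ //.
by rewrite -scalerBl scalerA mulrC /newton_value big_ord_recr.
Qed.

Lemma newton_value_eq0 th i k : (i < k)%N -> newton_value th k (th i) = 0.
Proof.
by move=> ltik; rewrite /newton_value (bigD1 (Ordinal ltik)) //= subrr mul0r.
Qed.

Lemma newton_value_neq0 A W th k :
  eigensystem A W th -> (k <= d)%N -> newton_value th k (th k) != 0.
Proof.
move=> eigA lekd; apply/prodf_neq0 => h _; rewrite subr_eq0.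
apply/eqP => /(eigsys_inj eigA) eqkh.
have := ltn_ord h; rewrite -eqkh ?ltnn // ltnS.
exact: leq_trans (ltnW (ltn_ord h)) lekd.
Qed.

(** The factor with eigenvalue [th j] kills [W j], so it removes the first summand of
    [upper_flag W j]. *)
Lemma newton_upper_flag A W th k v :
  eigensystem A W th -> newton A th k v \in upper_flag W k.
Proof.
move=> eigA; elim: k => [|k IHk].
  by rewrite upper_flag0 (eigsys_full eigA) memvf.
rewrite /= comp_lfunE.
by have /limg_subvP := eig_shift_upper_flag k eigA; apply.
Qed.

(** Each further factor climbs at most one step, so a vector one step below the bound of
    [newton_lower_flag] at [m] stays one step below it. *)
Lemma newton_lower_flagD A W th m k v :
  tridiagonal_action A W -> newton A th m v \in lower_flag W m ->
  newton A th (k + m) v \in lower_flag W (k + m).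
Proof.
move=> tdA Fv; elim: k => [//|k IHk]; rewrite addSn /= comp_lfunE.
by have /limg_subvP := shift_lower_flag (th (k + m)%N) (k + m) tdA; apply.
Qed.

Lemma newton_lower_flag A W th k v :
  tridiagonal_action A W -> v \in W ord0 ->
  newton A th k v \in lower_flag W k.+1.
Proof.
move=> tdA Wv; elim: k => [|k IHk].
  by rewrite id_lfunE (subvP (sumv_sup ord0 _ (subvv _))).
rewrite /= comp_lfunE.
by have /limg_subvP := shift_lower_flag (th k) k.+1 tdA; apply.
Qed.

(** The product of the first [d] factors kills every [W i] with [i < d] and is a nonzero scalar on
    the last eigenspace, so the last component of [v] must vanish. *)
Lemma newton_ker A W th v :
  eigensystem A W th -> newton A th d v = 0 -> v \in lower_flag W d.
Proof.
move=> eigA; have := memvf v; rewrite -(eigsys_full eigA).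
move=> /memv_sumP[vs Wvs ->]; rewrite linear_sum (bigD1 ord_max) //=.
rewrite big1 => [|i neid]; last first.
  have ltid : (i < d)%N by rewrite ltn_neqAle neid -ltnS ltn_ord.
  by rewrite (newton_eig _ eigA (Wvs i isT)) newton_value_eq0 ?scale0r.
rewrite addr0 (newton_eig _ eigA (Wvs ord_max isT)) => /eqP.
rewrite scaler_eq0 (negPf (newton_value_neq0 eigA _)) //= => /eqP vd0.
rewrite (bigD1 ord_max) //= vd0 add0r rpred_sum // => i neid.
apply: (subvP (sumv_sup i _ (subvv _))); last exact: Wvs.
by rewrite ltn_neqAle neid -ltnS ltn_ord.
Qed.

Lemma lower_flag_proper A W th :
  eigensystem A W th -> lower_flag W d <> fullv.
Proof.
move=> eigA flagT; apply: (eigsys_neq0 eigA (i := ord_max)).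
apply/eqP; rewrite -subv0; apply/subvP => v Wv.
have : v \in lower_flag W d by rewrite flagT memvf.
case/memv_sumP=> vs Wvs Dv.
have /eqP : newton A th d v = 0.
  rewrite Dv linear_sum big1 //= => i ltid.
  by rewrite (newton_eig _ eigA (Wvs i ltid)) newton_value_eq0 ?scale0r.
rewrite (newton_eig _ eigA Wv) scaler_eq0.
by rewrite (negPf (newton_value_neq0 eigA _)) //= memv0.
Qed.

Lemma newton_interpolation A W th e m :
  eigensystem A W th -> (m <= d.+1)%N ->
  exists c, forall i, (i < m)%N ->
    e i = \sum_(k < m) c k * newton_value th k (th i).
Proof.
move=> eigA; elim: m => [|m IHm] ltmd; first by exists (fun=> 0).
have [c Dc] := IHm (ltnW ltmd).
(* The new coefficient corrects the value at [th m]; the earlier nodes are unaffected, since the new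
   Newton polynomial vanishes there. *)
pose a := (e m - \sum_(k < m) c k * newton_value th k (th m))
            / newton_value th m (th m).
exists (fun k => if k == m then a else c k) => i.
rewrite big_ord_recr /= eqxx.
under eq_bigr => k _ do rewrite ltn_eqF //.
rewrite ltnS leq_eqVlt => /predU1P[-> | ltim].
  by rewrite divfK ?(newton_value_neq0 eigA) // addrC subrK.
by rewrite newton_value_eq0 // mulr0 addr0 Dc.
Qed.

(** Both maps are scalar on each [W i], so [B] is the polynomial in [A] that interpolates [e i] at
    the nodes [th i]. *)
Lemma newton_expansion A B W th e :
  eigensystem A W th -> eigensystem B W e ->
  exists c, forall v, B v = \sum_(k < d.+1) c k *: newton A th k v.
Proof.
move=> eigA eigB; have [c Dc] := newton_interpolation e eigA (leqnn d.+1).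
exists c => v; have := memvf v; rewrite -(eigsys_full eigA).
case/memv_sumP=> vs Wvs ->.
rewrite linear_sum.
under [RHS]eq_bigr => k _ do rewrite linear_sum scaler_sumr.
rewrite exchange_big /=; apply: eq_bigr => i _.
rewrite (eigsys_act eigB (Wvs i isT)) Dc // scaler_suml.
by apply: eq_bigr => k _; rewrite (newton_eig _ eigA (Wvs i isT)) scalerA.
Qed.

(** * Trivial intersection of opposite flags *)

Lemma flags_cap0 A B W Ws th ths k :
  (forall U, (A @: U <= U)%VS -> (B @: U <= U)%VS -> U = 0%VS \/ U = fullv) ->
  eigensystem A W th -> eigensystem B Ws ths ->
  tridiagonal_action B W -> tridiagonal_action A Ws ->
  (k <= d)%N -> (lower_flag Ws k :&: upper_flag W k = 0)%VS.
Proof.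
move=> irr eigA eigB tdB tdA lekd.
pose X j := (lower_flag Ws j :&: upper_flag W j)%VS.
pose U := (\sum_(j < d.+1) X j)%VS.
have sXU j : (j <= d.+1)%N -> (X j <= U)%VS.
  rewrite leq_eqVlt => /predU1P[->|ltjd].
    by rewrite /X upper_flag_ge capv0 sub0v.
  exact: (sumv_sup (Ordinal ltjd)).
have AU : (A @: U <= U)%VS.
  rewrite limg_sum; apply/subv_sumP => j _; apply/limg_subvP => v Xv.
  (* [A - th j] moves [X j] into [X j.+1]: it climbs one step in the lower flag of [Ws] and kills
     [W j]. *)
  rewrite -[A v](subrK (th j *: v)) -shiftE rpredD //; last first.
    by rewrite rpredZ // (subvP (sXU j _)) // ltnW.
  apply: (subvP (sXU j.+1 _)) => //; move: Xv; rewrite !memv_cap.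
  case/andP=> Fv Gv; apply/andP; split.
    by have /limg_subvP := shift_lower_flag (th j) j tdA; apply.
  by have /limg_subvP := eig_shift_upper_flag j eigA; apply.
have BU : (B @: U <= U)%VS.
  rewrite limg_sum.
  (* [X 0] is zero; on [X j.+1] the shift of [B] by [ths j] kills [Ws j] and descends to [X j]. *)
  apply/subv_sumP => [[[|j] ltjd]] _ /=; apply/limg_subvP => v.
    by rewrite /X lower_flag0 cap0v memv0 => /eqP->; rewrite linear0 mem0v.
  move=> Xv; rewrite -[B v](subrK (ths j *: v)) -shiftE rpredD //; last first.
    by rewrite rpredZ // (subvP (sXU j.+1 _)) // ltnW.
  apply: (subvP (sXU j _)); first by do 2 apply: ltnW.
  move: Xv; rewrite !memv_cap; case/andP=> Fv Gv; apply/andP; split.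
    by have /limg_subvP := eig_shift_lower_flag j eigB; apply.
  by have /limg_subvP := shift_upper_flag (ths j) j.+1 tdB; apply.
have [U0 | UT] := irr U AU BU.
  by apply/eqP; rewrite -subv0 -U0; apply: sXU; apply: leqW.
(* [U] cannot be everything, because each [X j] with [j <= d] lies in the proper subspace
   [lower_flag Ws d]. *)
case: (lower_flag_proper eigB); apply/eqP.
rewrite eqEsubv subvf -UT; apply/subv_sumP => j _.
by apply: subv_trans (capvSl _ _) (lower_flagS _ _); rewrite -ltnS.
Qed.

(** * Reversed orderings and extraction of eigenvalues *)

Lemma eigensystem_rev A W th :
  eigensystem A W th ->
  eigensystem A (fun i => W (rev_ord i)) (fun i => th (d - i)%N).
Proof.
case=> actA injA fullA neq0A; split.
- by move=> i v /actA; rewrite /= subSS.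
- move=> i j; rewrite !ltnS => leid lejd /injA.
  rewrite !ltnS !leq_subr => /(_ isT isT) eqij.
  by rewrite -(subKn leid) eqij subKn.
- by rewrite -fullA [RHS](reindex_inj rev_ord_inj).
- by move=> i; apply: neq0A.
Qed.

Lemma tridiagonal_action_rev A W :
  tridiagonal_action A W -> tridiagonal_action A (fun i => W (rev_ord i)).
Proof.
move=> tdA i; apply: subv_trans (tdA (rev_ord i)) _.
apply/subv_sumP => j /andP[] /=; rewrite subSS => leij leji.
apply: (sumv_sup (rev_ord j)); last by rewrite rev_ordK.
rewrite /= subSS; have lejd : (j <= d)%N by rewrite -ltnS.
have leid : (i <= d)%N by rewrite -ltnS.
move: leij leji; rewrite -!subSn // !leq_subLR.
rewrite !leq_subRL ?(leqW lejd) ?(leqW leid) //.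
by rewrite (addnC i) addSnnS [(i + j)%N]addnC => -> ->.
Qed.

Lemma eq_standard_ordering A B W W' :
  W =1 W' -> standard_ordering A B W -> standard_ordering A B W'.
Proof.
move=> eqW [[injW eigW] tdB]; split; last first.
  by move=> i; rewrite -eqW; under eq_bigr do rewrite -eqW; apply: tdB.
split=> [i j|U]; first by rewrite -!eqW => /injW.
by split=> [/eigW[i ->]|[i ->]]; [exists i | apply/eigW; exists i]; rewrite eqW.
Qed.

Lemma eigensystem_exists A W :
  ldiagonalizable A -> leigenspace_ordering A W ->
  exists th, eigensystem A W th.
Proof.
case=> Us [eigU fullU] [injW eigW].
have Weig i : is_leigenspace A (W i) by apply/eigW; exists i.
have /fin_all_exists[th Dth] i := proj2 (Weig i).
(* [inord] extends the eigenvalues from ordinals to [nat]; the values beyond [d] are junk. *)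
exists (fun n => th (inord n)); split.
- move=> i v; rewrite inord_val Dth memv_ker add_lfunE opp_lfunE scale_lfunE.
  by rewrite id_lfunE subr_eq0 => /eqP.
- move=> i j ltid ltjd eqth.
  have /injW/(congr1 val) : W (inord i) = W (inord j) by rewrite !Dth eqth.
  by rewrite /= !inordK.
(* Every eigenspace in the spanning list [Us] is some [W i], so the [W i] span as well. *)
- apply/eqP; rewrite eqEsubv subvf -fullU big_seq /=.
  elim/big_rec: _ => [|U X UsU sXW]; first exact: sub0v.
  rewrite subv_add sXW andbT.
  have /eigW[i ->] := eigU U UsU.
  exact: (sumv_sup i).
- by move=> i; case: (Weig i).
Qed.

(** * Bounding the degree of the Newton expansion *)

Lemma standard_eigenspaces_span A As A' As' W Ws :
  tridiagonal_pair A As ->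
  standard_ordering A As W -> standard_ordering As A Ws ->
  tridiagonal_pair A' As' ->
  standard_ordering A' As' W -> standard_ordering As' A' Ws ->
  A' \in <<[:: A; \1%VF]>>%VS.
Proof.
move=> [diagA diagAs _ _ irr] [ordA tdAs] [ordAs tdA].
move=> [diagA' _ _ _ _] [ordA' _] [_ tdA'].
have [th eigA] := eigensystem_exists diagA ordA.
have [ths eigAs] := eigensystem_exists diagAs ordAs.
have [th' eigA'] := eigensystem_exists diagA' ordA'.
have [c Dc] := newton_expansion eigA eigA'.
have FG0 := flags_cap0 irr eigA eigAs tdAs tdA (leqnn d).
(* This is [flags_cap0] with the two maps exchanged and [Ws] reversed, so that [Ws ord0] becomes the
   last space and is the whole upper flag at [d]. *)
have Ws0 v : v \in lower_flag W d -> v \in Ws ord0 -> v = 0.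
  move=> Fv Wsv; apply/eqP; rewrite -memv0.
  rewrite -(flags_cap0 (fun U sAs sA => irr U sA sAs) (eigensystem_rev eigAs)
             eigA (tridiagonal_action_rev tdA) tdAs (leqnn d)).
  rewrite memv_cap Fv (subvP (sumv_sup ord_max _ (subvv _))) //.
  by rewrite (_ : rev_ord _ = ord0) //; apply: val_inj; rewrite /= subnn.
have c0 k : (1 < k <= d)%N -> c k = 0.
  move=> k_range; apply/eqP/negPn/negP => ck_neq0.
  pose P m := (1 < m <= d)%N && (c m != 0).
  have Pk : exists m, P m by exists k; rewrite /P k_range.
  have Pd m : P m -> (m <= d)%N by case/andP=> /andP[].
  case: (ex_maxnP Pk Pd) => r /andP[/andP[r_gt1 lerd] cr_neq0] maxr.
  apply: (eigsys_neq0 eigAs (i := ord0)).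
  apply/eqP; rewrite -subv0; apply/subvP => v Wsv; rewrite memv0.
  apply/eqP/Ws0 => //; apply: (newton_ker eigA).
  (* Membership in the upper flag is automatic; membership in the lower flag at [d] propagates from
     the same statement at [r]. *)
  apply/eqP; rewrite -memv0 -FG0 memv_cap (newton_upper_flag _ _ eigA) andbT.
  rewrite -(subnK lerd); apply: newton_lower_flagD => //.
  have Fr : c r *: newton A th r v \in lower_flag Ws r.
    have FA'v : A' v \in lower_flag Ws r.
      apply: (subvP (lower_flagS Ws r_gt1)).
      (* [A'] is its own shift by zero, so it sends [Ws ord0] into the lower flag at 2, and
         [r >= 2]. *)
      rewrite -[A' v](subrK (0 *: v)) -shiftE scale0r addr0.
      have /limg_subvP := shift_lower_flag 0 1 tdA'; apply.
      by apply: (subvP (sumv_sup ord0 _ (subvv _))).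
    have ltrd : (r < d.+1)%N by [].
    (* It remains to place the other terms in the lower flag at [r]: those with [m < r] lie in the
       flag at [m.+1], and those with [m > r] vanish by maximality of [r]. *)
    move: FA'v; rewrite Dc (bigD1 (Ordinal ltrd)) //= rpredDr //.
    apply: rpred_sum => m neqmr; have [ltmr | lerm] := ltnP m r.
      rewrite rpredZ // (subvP (lower_flagS Ws ltmr)) //.
      exact: newton_lower_flag.
    have ltrm : (r < m)%N by rewrite ltn_neqAle lerm andbT eq_sym.
    have [-> | cm_neq0] := eqVneq (c m) 0; first by rewrite scale0r mem0v.
    have /maxr : P m.
      by rewrite /P cm_neq0 (ltn_trans r_gt1 ltrm) -ltnS ltn_ord.
    by rewrite leqNgt ltrm.
  by rewrite -(scalerK cr_neq0 (newton A th r v)) rpredZ.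
have span1 : \1%VF \in <<[:: A; \1%VF]>>%VS.
  by apply: memv_span; rewrite !inE eqxx orbT.
have -> : A' = \sum_(k < d.+1) c k *: newton A th k.
  apply/lfunP => v; rewrite Dc sum_lfunE.
  by apply: eq_bigr => k _; rewrite scale_lfunE.
(* Only the identity and [A - th 0] survive in the expansion. *)
apply: rpred_sum => [[[|[|k]] ltkd]] _ /=.
- by rewrite rpredZ.
- rewrite rpredZ // comp_lfun1r rpredB // ?rpredZ //.
  by apply: memv_span; rewrite !inE eqxx.
- by rewrite c0 // scale0r mem0v.
Qed.

Lemma standard_eigenspaces_span_eq A As A' As' W Ws :
  tridiagonal_pair A As ->
  standard_ordering A As W -> standard_ordering As A Ws ->
  tridiagonal_pair A' As' ->
  standard_ordering A' As' W -> standard_ordering As' A' Ws ->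
  <<[:: A; \1%VF]>>%VS = <<[:: A'; \1%VF]>>%VS.
Proof.
move=> tdp ordW ordWs tdp' ordW' ordWs'.
apply/eqP; rewrite eqEsubv; apply/andP; split; apply/span_subvP => B.
all: rewrite !inE => /orP[] /eqP->.
all: try by apply: memv_span; rewrite !inE eqxx orbT.
  exact: standard_eigenspaces_span tdp' ordW' ordWs' tdp ordW ordWs.
exact: standard_eigenspaces_span tdp ordW ordWs tdp' ordW' ordWs'.
Qed.

End Flags.

End TridiagonalPairs.

Theorem theorem4p2 (K : fieldType) (V : vectType K)
  (dimV_gt0 : (0 < \dim {:V})%N)
  (A As A' As' : 'End(V)) (d : nat)
  (W Ws W' Ws' : 'I_d.+1 -> {vspace V})
  (tdpA : tridiagonal_pair A As)
  (ordW : standard_ordering A As W)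
  (ordWs : standard_ordering As A Ws)
  (tdpA' : tridiagonal_pair A' As')
  (ordW' : standard_ordering A' As' W')
  (ordWs' : standard_ordering As' A' Ws')
  (eqW : forall i : 'I_d.+1, W i = W' i)
  (eqWs : forall i : 'I_d.+1, Ws i = Ws' i) :
  <<[:: A; \1%VF]>>%VS = <<[:: A'; \1%VF]>>%VS /\
  <<[:: As; \1%VF]>>%VS = <<[:: As'; \1%VF]>>%VS.
Proof.
have ordA' := eq_standard_ordering (fun i => esym (eqW i)) ordW'.
have ordAs' := eq_standard_ordering (fun i => esym (eqWs i)) ordWs'.
split.
  exact: standard_eigenspaces_span_eq tdpA ordW ordWs tdpA' ordA' ordAs'.
(* The definition of a tridiagonal pair is symmetric in its two maps, so the dual equality follows
   by exchanging them. *)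
exact: standard_eigenspaces_span_eq (tridiagonal_pair_sym tdpA) ordWs ordW
  (tridiagonal_pair_sym tdpA') ordAs' ordA'.
Qed.
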